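(* Let $n\ge 1$ and let $(\xi_i,\mathcal{F}_i)_{i=1,\dots,n}$ be supermartingale differences satisfying $\xi_i\le 1$ for all $i=1,\dots,n$. Let $X_k=\sum_{i=1}^k\xi_i$ and $\langle X\rangle_k=\sum_{i=1}^k\mathbb{E}(\xi_i^2|\mathcal{F}_{i-1})$ for $k=1,\dots,n$. Then, for any $x\ge 0$ and $v>0$, $$\mathbb{P}\left(X_k\ge x\ \text{and}\ \langle X\rangle_k\le v^2\ \text{for some}\ k\in[1,n]\right)\le H_n(x,v),$$ where $$H_n(x,v)=\left\{\left(\frac{v^2}{x+v^2}\right)^{x+v^2}\left(\frac{n}{n-x}\right)^{n-x}\right\}^{\frac{n}{n+v^2}}\mathbf{1}_{\{x\le n\}},$$ with the convention that $(+\infty)^0=1$ (which applies when $x=n$).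
   Context: Setting: $(\Omega,\mathcal{F},\mathbb{P})$ is a probability space and $\{\emptyset,\Omega\}=\mathcal{F}_0\subseteq\mathcal{F}_1\subseteq\dots\subseteq\mathcal{F}_n\subseteq\mathcal{F}$ are increasing $\sigma$-fields. ''$(\xi_i,\mathcal{F}_i)_{i=1,\dots,n}$ are supermartingale differences'' means that each $\xi_i$ is a real integrable $\mathcal{F}_i$-measurable random variable with $\mathbb{E}(\xi_i|\mathcal{F}_{i-1})\le 0$, $i=1,\dots,n$. Conditional expectations of nonnegative random variables are understood in the generalized sense, with values in $[0,+\infty]$. The index $k$ ranges over integers. Because of the indicator, $H_n(x,v)=0$ for $x>n$. *)

(* Defs.v *)
From HB Require Import structures.
From mathcomp Require Import all_boot all_order all_algebra.
From mathcomp Require Import all_classical all_reals all_analysis.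
From mathcomp Require Import measurable_realfun.
Set Implicit Arguments.
Unset Strict Implicit.
Unset Printing Implicit Defensive.
Import Order.TTheory GRing.Theory Num.Theory.
Import numFieldNormedType.Exports.
Local Open Scope classical_set_scope.
Local Open Scope ring_scope.

Section ConditionalExpectation.
Context (d : measure_display) (T : measurableType d) (R : realType).
Variable P : probability T R.

(* [g_sigma_algebraType G] is T with the sigma-field generated by G; this
   sigma-field is G itself when G is a sigma-field. *)
Definition measurable_wrt (G : set (set T)) (d' : measure_display)
    (U : measurableType d') (f : T -> U) : Prop :=
  measurable_fun [set: g_sigma_algebraType G] f.

(* g is a version of E(f | G), for f integrable. *)
Definition is_condexp (G : set (set T)) (f g : T -> \bar R) : Prop :=
  [/\ measurable_wrt G g,
      P.-integrable [set: T] g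
    & forall A, G A -> (\int[P]_(w in A) g w = \int[P]_(w in A) f w)%E].

(* g is a version of the generalized E(f | G), with values in [0, +oo], for f
   nonnegative and not necessarily integrable. *)
Definition is_condexp_ge0 (G : set (set T)) (f g : T -> \bar R) : Prop :=
  [/\ measurable_wrt G g,
      forall w, (0 <= g w)%E
    & forall A, G A -> (\int[P]_(w in A) g w = \int[P]_(w in A) f w)%E].

Definition filtration (n : nat) (F : nat -> set (set T)) : Prop :=
  [/\ F 0%N = [set set0; setT],
      forall i, (i <= n)%N -> sigma_algebra setT (F i),
      forall i, (i < n)%N -> F i `<=` F i.+1
    & F n `<=` measurable].

Definition supermartingale_differences (n : nat) (F : nat -> set (set T))
    (xi : nat -> T -> R) : Prop :=
  forall i, (1 <= i <= n)%N ->
    [/\ P.-integrable [set: T] (EFin \o xi i),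
        measurable_wrt (F i) (xi i)
      & exists2 g, is_condexp (F i.-1) (EFin \o xi i) g &
          {ae P, forall w, (g w <= 0)%E}].

End ConditionalExpectation.

(* At x = n, the library's n / 0 = 0 and 0 `^ 0 = 1 give the second factor the
   value 1, in agreement with the convention (+oo)^0 = 1. *)
Definition H (R : realType) (n : nat) (x v : R) : R :=
  if x <= n%:R then
    ((v ^+ 2 / (x + v ^+ 2)) `^ (x + v ^+ 2) *
     (n%:R / (n%:R - x)) `^ (n%:R - x)) `^ (n%:R / (n%:R + v ^+ 2))
  else 0.

(* Main.v *)
Require Import Defs.
From HB Require Import structures.
From mathcomp Require Import all_boot all_order all_algebra.
From mathcomp Require Import all_classical all_reals all_analysis.
From mathcomp Require Import measurable_realfun.
From mathcomp Require Import ring lra.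
Set Implicit Arguments.
Unset Strict Implicit.
Unset Printing Implicit Defensive.
Import Order.TTheory GRing.Theory Num.Theory.
Import numFieldNormedType.Exports.
Local Open Scope classical_set_scope.
Local Open Scope ring_scope.

Import HBNNSimple.

(** For lambda > 0 and s = v^2/n, let q(y) = a + b y + c y^2 be the parabola
tangent to exp(lambda y) at y = -s and meeting it at y = 1.  It dominates
exp(lambda y) on y <= 1, and b, c >= 0, so with sigma_i^2 = E(xi_i^2 | F_{i-1})
  E(exp(lambda xi_i) | F_{i-1}) <= a + c sigma_i^2
                                <= B exp(kappa (sigma_i^2 - s)),
where B = a + c s and kappa = c / B.  Hence
  Z_k = prod_{i <= k} exp(lambda xi_i - kappa (sigma_i^2 - s)) / B
is a supermartingale.  As a = B (1 - kappa s) and a = q(0) >= 1, we have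
B exp(- kappa s) >= 1, which gives Z_k >= exp(lambda x) B^-n on the event
{X_k >= x, <X>_k <= v^2}; the maximal inequality bounds the probability by
exp(- lambda x) B^n, where
  B = (exp(- lambda s) + s exp(lambda)) / (1 + s).
The optimal lambda is given by
exp(lambda (1 + s)) = n (x + v^2) / (v^2 (n - x)); for x = n it is infinite. *)

(** * Exponential inequalities and the dominating parabola *)

Section RealBounds.
Variable R : realType.
Implicit Types l s t y z : R.

Lemma ge0_derive_homo (f df : R -> R) :
  (forall y, is_derive y 1 f (df y)) -> (forall y : R, 0 < y -> 0 <= df y) ->
  forall z : R, 0 <= z -> f 0 <= f z.
Proof.
move=> fdf df0 z z0; apply: (@ger0_derive1_ndecry _ f 0) => //.
- move=> y; rewrite in_itv/= andbT derive1E => y0.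
  by rewrite (@derive_val _ _ _ _ _ _ _ (fdf y)); exact: df0.
- apply: continuous_subspaceT => y.
  apply/differentiable_continuous/derivable1_diffP.
  exact: (@ex_derive _ _ _ _ _ _ _ (fdf y)).
Qed.

Lemma expR_ge_quad z : 0 <= z -> 1 + z + z ^+ 2 / 2 <= expR z.
Proof.
move=> z0; rewrite -subr_ge0.
pose f y := expR y - (1 + y + y ^+ 2 / 2).
have -> : 0 = f 0 by rewrite /f expR0; ring.
apply: (@ge0_derive_homo f (fun y => expR y - 1 - y)) => // y.
  rewrite /f; apply: is_derive_eq.
  by rewrite /GRing.scale/=; field.
by move=> _; have := expR_ge1Dx y; lra.
Qed.

(** The difference of the two sides vanishes at [y = 0], and its derivative is [t] times the gap in
    the convexity inequality exp(t y) <= t exp(y) + 1 - t. *)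
Lemma expR_quad_mono_pos t y : 0 <= t <= 1 -> 0 <= y ->
  expR (t * y) - 1 - t * y <= t ^+ 2 * (expR y - 1 - y).
Proof.
move=> /andP[t0 t1] y0; rewrite -subr_ge0.
pose f y := t ^+ 2 * (expR y - 1 - y) - (expR (t * y) - 1 - t * y).
have -> : 0 = f 0 by rewrite /f mulr0 expR0; ring.
apply: (@ge0_derive_homo f
  (fun y => t ^+ 2 * (expR y - 1) - t * (expR (t * y) - 1))) => // {y0}y.
  rewrite /f; apply: is_derive_eq.
  by rewrite /GRing.scale/=; ring.
move=> _; have := @convex_expR R (Itv01 t0 t1) y 0.
rewrite !convRE/= expR0 mulr0 addr0 => h.
have -> : t ^+ 2 * (expR y - 1) - t * (expR (t * y) - 1) =
  t * (t * expR y + (1 - t) * 1 - expR (t * y)) by ring.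
rewrite mulr_ge0// subr_ge0; exact: h.
Qed.

(** This is the monotonicity of (exp(y) - 1 - y) / y^2, with denominators cleared so that [y = 0] is
    covered. For [y >= 0] it is [expR_quad_mono_pos] at the ratio [y / z]; for [y < 0] the value 1/2
    separates the two quotients. *)
Lemma expR_quad_mono y z : 0 < z -> y <= z ->
  z ^+ 2 * (expR y - 1 - y) <= y ^+ 2 * (expR z - 1 - z).
Proof.
move=> z0 yz; have [y0|y0] := leP 0 y.
  have yz01 : 0 <= y / z <= 1.
    by rewrite divr_ge0 ?(ltW z0)//= ler_pdivrMr// mul1r.
  have h := expR_quad_mono_pos yz01 (ltW z0); rewrite divfK ?gt_eqF// in h.
  have -> : y ^+ 2 * (expR z - 1 - z) =
     z ^+ 2 * ((y / z) ^+ 2 * (expR z - 1 - z)) by field; rewrite gt_eqF.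
  by rewrite ler_pM2l ?exprn_gt0.
have hz := expR_ge_quad (ltW z0).
have ny0 : 0 <= - y by lra.
have hy := expR_ge_quad ny0.
(* Since exp(-y) >= 1 - y + y^2/2, it suffices that the product (1 + y + y^2/2) (1 - y + y^2/2) = 1
   + y^4/4 is at least 1. *)
have {}hy : expR y <= 1 + y + y ^+ 2 / 2.
  rewrite -[y]opprK expRN [- - y]opprK -[leLHS]mul1r ler_pdivrMr ?expR_gt0//.
  have : 1 <= (1 + y + y ^+ 2 / 2) * (1 + - y + (- y) ^+ 2 / 2).
    have -> : (1 + y + y ^+ 2 / 2) * (1 + - y + (- y) ^+ 2 / 2) =
      1 + (y ^+ 2) ^+ 2 / 4 by field.
    by rewrite lerDl divr_ge0// exprn_even_ge0.
  move/le_trans; apply; rewrite ler_wpM2l//; nra.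
apply: (@le_trans _ _ (z ^+ 2 * (y ^+ 2 / 2))).
  by rewrite ler_wpM2l ?sqr_ge0//; lra.
rewrite mulrCA ler_wpM2l ?sqr_ge0//; lra.
Qed.

(** Factoring out exp(-l s) reduces the domination to [expR_quad_mono] at l (y + s) <= l (1 + s),
    that is, at y <= 1. The value of [a + c * s] is the mean of the parabola for a variable of mean
    zero and second moment [s]. *)
Lemma expR_le_quadratic s l : 0 <= s -> 0 < l -> exists a b c,
  [/\ 0 <= b, 0 <= c,
      a + c * s = (expR (- (l * s)) + s * expR l) / (1 + s)
    & forall y, y <= 1 -> expR (l * y) <= a + b * y + c * y ^+ 2].
Proof.
move=> s0 l0; pose E := expR (- (l * s)); pose z := l * (1 + s).
have z0 : 0 < z by rewrite mulr_gt0//; lra.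
pose G := (expR z - 1 - z) / (1 + s) ^+ 2.
have G0 : 0 <= G.
  by rewrite divr_ge0 ?sqr_ge0//; have := expR_ge1Dx z; lra.
have E0 : 0 < E := expR_gt0 _.
(* These are the coefficients, in powers of [y], of E (1 + l (y + s) + G (y + s)^2); [G] is fixed by
   equality with exp(l y) at y = 1. *)
exists (E * (1 + l * s + G * s ^+ 2)), (E * (l + 2 * G * s)), (E * G).
split.
- apply: mulr_ge0; first exact: ltW.
  apply: addr_ge0; first exact: ltW.
  by apply: mulr_ge0 => //; lra.
- by rewrite mulr_ge0 ?(ltW E0).
- have -> : expR l = E * expR z by rewrite -expRD /z; congr expR; ring.
  by rewrite -/E /G /z; field; lra.
move=> y y1.
have -> : expR (l * y) = E * expR (l * (y + s)).
  by rewrite -expRD; congr expR; ring.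
have := @expR_quad_mono (l * (y + s)) z z0 _.
rewrite ler_pM2l// lerD2r => /(_ y1) h.
have {}h : expR (l * (y + s)) - 1 - l * (y + s) <= G * (y + s) ^+ 2.
  rewrite -(@ler_pM2l _ (z ^+ 2)) ?exprn_gt0// (le_trans h)//.
  by rewrite /G /z le_eqVlt; apply/orP; left; apply/eqP; field; lra.
have -> : E * (1 + l * s + G * s ^+ 2) + E * (l + 2 * G * s) * y +
    E * G * y ^+ 2 = E * (1 + l * (y + s) + G * (y + s) ^+ 2) by ring.
rewrite ler_pM2l//; lra.
Qed.

End RealBounds.

(** * Optimization of the exponential bound over its parameter *)

Section HBound.
Variable R : realType.

(** For x < n the function [H] is the value of the bound at the optimal [l]; for x = n it is the
    limit of the bound as [l] tends to infinity. *)
Lemma le_H (n : nat) (x v p : R) :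
  (0 < n)%N -> 0 < x <= n%:R -> 0 < v ->
  (forall l : R, 0 < l -> p <= expR (- (l * x)) *
     ((expR (- (l * (v ^+ 2 / n%:R))) + v ^+ 2 / n%:R * expR l) /
      (1 + v ^+ 2 / n%:R)) ^+ n) ->
  p <= H n x v.
Proof.
move=> n0 /andP[x0 xn] v0 hp; rewrite /H xn.
have N0 : 0 < n%:R :> R by rewrite ltr0n.
have w0 : 0 < v ^+ 2 by rewrite exprn_gt0.
have s0 : 0 < v ^+ 2 / n%:R by rewrite divr_gt0.
have [xE|xn'] := eqVneq x n%:R.
  rewrite xE subrr powRr0 mulr1 -powRrM.
  have -> : (n%:R + v ^+ 2) * (n%:R / (n%:R + v ^+ 2)) = n%:R.
    by field; rewrite gt_eqF// addr_gt0.
  rewrite powR_mulrn; last by rewrite divr_ge0 ?addr_ge0 ?ltW.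
  have -> : v ^+ 2 / (n%:R + v ^+ 2) = v ^+ 2 / n%:R / (1 + v ^+ 2 / n%:R).
    by field; rewrite !gt_eqF// addr_gt0.
  set s := v ^+ 2 / n%:R in s0 hp *.
  (* In the variable u = exp(-l (1 + s)), the bound for x = n is [f u]. Large [l] means [u] close to
     0 from the right, and [f] is continuous there. *)
  pose f u := ((u + s) / (1 + s)) ^+ n.
  have fc : f u @[u --> 0^'+] --> f 0.
    apply: cvg_at_right_filter.
    apply: (@cvg_comp _ _ _ (fun u => (u + s) / (1 + s)) (fun y => y ^+ n)).
      by apply: cvgM; [apply: cvgD; [exact: cvg_id|]|]; exact: cvg_cst.
    exact: exprn_continuous.
  suff : p <= f 0 by rewrite /f add0r.
  rewrite -(cvg_lim _ fc)//; apply: limr_ge.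
    by apply/cvg_ex; exists (f 0).
  near=> u.
  have u0 : 0 < u by near: u; exact: nbhs_right_gt.
  have u1 : u < 1 by near: u; exact: nbhs_right_lt.
  pose l := - ln u / (1 + s).
  have l0 : 0 < l by rewrite divr_gt0 ?oppr_gt0 ?ln_lt0 ?u0//; lra.
  have uE : u = expR (- (l * (1 + s))).
    by rewrite /l divfK ?opprK ?lnK//; rewrite gt_eqF//; lra.
  apply: (le_trans (hp l l0)).
  have -> : - (l * x) = n%:R * - l by rewrite xE mulrN mulrC.
  rewrite expRM_natl -exprMn /f uE le_eqVlt; apply/orP; left; apply/eqP.
  congr (_ ^+ n).
  have -> : - (l * (1 + s)) = - l + - (l * s) by ring.
  rewrite expRD [expR (- l)]expRN.
  by field; rewrite !gt_eqF ?expR_gt0//; lra.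
have {xn xn'} xn : x < n%:R by rewrite lt_neqAle xn'.
have d0 : 0 < n%:R - x by rewrite subr_gt0.
have xw0 : 0 < x + v ^+ 2 by rewrite addr_gt0.
have nw0 : 0 < n%:R + v ^+ 2 by rewrite addr_gt0.
have a0 : 0 < v ^+ 2 / (x + v ^+ 2) by rewrite divr_gt0.
have b0 : 0 < n%:R / (n%:R - x) by rewrite divr_gt0.
(* With the logarithms of the two bases in [H], the claim becomes an identity between exponents. The
   signs L1 < 0 < L2, which rely on x > 0, make the optimal [l] positive. *)
pose L1 := ln (v ^+ 2 / (x + v ^+ 2)); pose L2 := ln (n%:R / (n%:R - x)).
have E1 : expR L1 = v ^+ 2 / (x + v ^+ 2) by rewrite lnK.
have E2 : expR L2 = n%:R / (n%:R - x) by rewrite lnK.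
rewrite -E1 -E2 -!expRM -expRD -expRM.
have L10 : L1 < 0 by rewrite ln_lt0// a0 ltr_pdivrMr//; lra.
have L20 : 0 < L2 by rewrite ln_gt0// ltr_pdivlMr//; lra.
pose s := v ^+ 2 / n%:R.
pose l := (L2 - L1) / (1 + s).
have l0 : 0 < l by rewrite divr_gt0//; rewrite /s; lra.
apply: (le_trans (hp l l0)); rewrite -/s.
have -> : expR l = expR (- (l * s)) * (expR L2 / expR L1).
  rewrite -expRN -!expRD; congr expR; rewrite /l; field; rewrite /s; lra.
(* For this [l], (1 + s exp(L2 - L1)) / (1 + s) = n / (n - x) = exp(L2). *)
have -> : (expR (- (l * s)) +
    s * (expR (- (l * s)) * (expR L2 / expR L1))) / (1 + s) =
    expR (L2 - l * s).
  by rewrite expRD E1 E2 /s; field; rewrite !gt_eqF.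
rewrite -expRM_natl -expRD le_eqVlt; apply/orP; left; apply/eqP; congr expR.
by rewrite /l /s; field; rewrite !gt_eqF.
Unshelve. all: end_near.
Qed.
End HBound.

(** * Integration against weights measurable for a sub-sigma-field *)

Section SubSigmaField.
Context (d : measure_display) (T : measurableType d).
Implicit Types G : set (set T).

Lemma sigma_measurableE G : sigma_algebra setT G ->
  @measurable _ (g_sigma_algebraType G) = G.
Proof. exact: sigma_algebra_id. Qed.

Lemma measurable_wrt_trans G G' (d' : measure_display) (U : measurableType d')
    (f : T -> U) :
  sigma_algebra setT G -> sigma_algebra setT G' -> G `<=` G' ->
  measurable_wrt G f -> measurable_wrt G' f.
Proof.
move=> sG sG' GG' mf _ B mB.
have := mf measurableT B mB.
rewrite !sigma_measurableE//; exact: GG'.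
Qed.

Lemma measurable_wrt_fun G (d' : measure_display) (U : measurableType d')
    (f : T -> U) :
  sigma_algebra setT G -> G `<=` measurable ->
  measurable_wrt G f -> measurable_fun setT f.
Proof.
move=> sG Gm mf _ B mB.
have := mf measurableT B mB.
rewrite sigma_measurableE//; exact: Gm.
Qed.

Context (R : realType) (P : probability T R).

(** The weight is simple for the sub-sigma-field, whereas the integral is over the ambient space.
    Decomposing it into indicators of level sets brings in integrals over sets of [G] only. *)
Lemma ge0_integral_nnsfunM G (h : {nnsfun (g_sigma_algebraType G) >-> R})
    (f : T -> \bar R) : sigma_algebra setT G -> G `<=` measurable ->
  measurable_fun setT f -> (forall x, 0 <= f x)%E ->
  (\int[P]_x ((h x)%:E * f x) =
   \sum_(r \in range h) r%:E * \int[P]_(x in h @^-1` [set r]) f x)%E.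
Proof.
move=> sG Gm mf f0.
have mh : measurable_fun (setT : set T) h.
  by apply: (measurable_wrt_fun sG Gm); exact: measurable_funP.
have mhr r : measurable (h @^-1` [set r] : set T).
  by rewrite -[X in measurable X]setTI; exact: mh.
transitivity (\int[P]_x
    (\sum_(r \in range h) (r * \1_(h @^-1` [set r]) x)%:E * f x))%E.
  apply: eq_integral => x _.
  rewrite -ge0_mule_fsuml; last by move=> y; exact: nnfun_muleindic_ge0.
  by rewrite fsumEFin //; congr (_%:E * _)%E; exact: fimfunE.
rewrite ge0_integral_fsum//; last 2 first.
  - move=> y; apply: emeasurable_funM => //; apply/measurable_EFinP.
    by apply: measurable_funM => //; exact: measurable_indic.
  - by move=> m y Ey; rewrite mule_ge0// nnfun_muleindic_ge0.
apply: eq_fsbigr => r rhn.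
under eq_integral do rewrite EFinM -muleA.
rewrite ge0_integralZl//.
- congr (_ * _)%E; rewrite [RHS]integral_mkcond; apply: eq_integral => x _.
  by rewrite epatch_indic muleC.
- apply: emeasurable_funM => //; apply/measurable_EFinP.
  exact: measurable_indic.
- by move=> t Et; rewrite mule_ge0 ?lee_fin.
- by move: rhn; rewrite inE => -[t _ <-]; rewrite lee_fin.
Qed.

(** This replaces taking a known factor out of a conditional expectation. The inequality passes from
    sets of [G] to simple weights by linearity, then to [Y] by monotone convergence; all integrals
    may be infinite. *)
Lemma le_integral_measurable_wrtM G (Y : T -> \bar R) (u : T -> R)
    (w : T -> \bar R) : sigma_algebra setT G -> G `<=` measurable ->
  measurable_wrt G Y -> (forall x, 0 <= Y x)%E ->
  measurable_fun setT u -> (forall x, 0 <= u x) ->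
  measurable_fun setT w -> (forall x, 0 <= w x)%E ->
  (forall A, G A -> (\int[P]_(x in A) (u x)%:E <= \int[P]_(x in A) w x)%E) ->
  (\int[P]_x (Y x * (u x)%:E) <= \int[P]_x (Y x * w x))%E.
Proof.
move=> sG Gm mY Y0 mu u0 mw w0 uw.
pose h := nnsfun_approx measurableT mY.
have hY x : (EFin \o (fun n => h n x)) n @[n --> \oo] --> Y x.
  exact: cvg_nnsfun_approx.
have hh x : {homo (fun n => h n x) : n m / (n <= m)%N >-> n <= m}.
  by move=> n m nm; exact/lefP/nd_nnsfun_approx.
have mh n : measurable_fun (setT : set T) (h n).
  by apply: (measurable_wrt_fun sG Gm); exact: measurable_funP.
have h0 n x : 0 <= h n x by exact: fun_ge0.
have hle n x : ((h n x)%:E <= Y x)%E.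
  have hE : {homo (EFin \o (fun n => h n x)) : n m / (n <= m)%N >-> (n <= m)%E}.
    by move=> p q pq; rewrite lee_fin hh.
  rewrite -(cvg_lim _ (hY x))//.
  rewrite (cvg_lim _ (ereal_nondecreasing_cvgn hE))//.
  by apply: ereal_sup_ubound; exists n.
have -> : (\int[P]_x (Y x * (u x)%:E) =
    limn (fun n => \int[P]_x ((h n x)%:E * (u x)%:E)))%E.
  rewrite -(monotone_convergence P measurableT)//.
  - apply: eq_integral => x _; apply/esym/cvg_lim => //.
    by apply: cvgeZr => //; exact: hY.
  - move=> n; apply: emeasurable_funM; exact/measurable_EFinP.
  - by move=> n x _; rewrite mule_ge0 ?lee_fin.
  - by move=> x _ p q pq; rewrite lee_wpmul2r ?lee_fin ?hh.
apply: lime_le.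
  apply: ereal_nondecreasing_is_cvgn => p q pq; apply: ge0_le_integral => //.
  - by move=> x _; rewrite mule_ge0 ?lee_fin.
  - by apply: emeasurable_funM; exact/measurable_EFinP.
  - by apply: emeasurable_funM; exact/measurable_EFinP.
  - by move=> x _; rewrite lee_wpmul2r ?lee_fin ?hh.
(* Only the left integral needs a limit: on the right, [h n <= Y] already bounds every term. *)
apply: nearW => n.
apply: (@le_trans _ _ (\int[P]_x ((h n x)%:E * w x))%E); last first.
  apply: ge0_le_integral => //.
  - by move=> x _; rewrite mule_ge0 ?lee_fin.
  - by apply: emeasurable_funM => //; exact/measurable_EFinP.
  - by apply: emeasurable_funM => //; exact: (measurable_wrt_fun sG Gm mY).
  - by move=> x _; rewrite lee_wpmul2r.
rewrite (ge0_integral_nnsfunM _ sG Gm)//; last exact/measurable_EFinP.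
rewrite (ge0_integral_nnsfunM _ sG Gm)//.
rewrite !fsbig_finite//= !big_seq; apply: lee_sum => r.
rewrite in_fset_set// inE => -[x _ <-].
rewrite lee_wpmul2l ?lee_fin//; apply: uw.
suff : @measurable _ (g_sigma_algebraType G) (h n @^-1` [set h n x]).
  by rewrite sigma_measurableE.
by rewrite -[X in measurable X]setTI; exact: measurable_funP.
Qed.

Lemma filtration_le (n : nat) (F : nat -> set (set T)) i j :
  filtration n F -> (i <= j <= n)%N -> F i `<=` F j.
Proof.
move=> [_ _ FS _] /andP[/subnKC]; move: (j - i)%N => k <-; elim: k => [|k IH].
  by rewrite addn0 => _ A.
by rewrite addnS => kn; apply: subset_trans (FS _ kn); apply: IH; exact: ltnW.
Qed.

Lemma filtration_measurable (n : nat) (F : nat -> set (set T)) i :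
  filtration n F -> (i <= n)%N -> F i `<=` measurable.
Proof.
move=> hF hi; have [_ _ _ Fm] := hF.
by apply: subset_trans Fm; apply: (filtration_le hF); rewrite hi leqnn.
Qed.
End SubSigmaField.

(** * A maximal inequality for nonnegative supermartingales *)

Section Doob.
Context (d : measure_display) (T : measurableType d) (R : realType)
  (P : probability T R).

(** Induction on the time horizon takes the place of optional stopping at the first [k] for which
    [E k] occurs. *)
Lemma maximal_inequality (n : nat) (F : nat -> set (set T))
    (Z : nat -> T -> R) (E : nat -> set T) (c : R) :
  filtration n F ->
  (forall k, (k <= n)%N -> measurable_fun setT (Z k)) ->
  (forall k w, (k <= n)%N -> 0 <= Z k w) ->
  (forall k A, (k < n)%N -> F k A ->
    (\int[P]_(w in A) (Z k.+1 w)%:E <= \int[P]_(w in A) (Z k w)%:E)%E) ->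
  (forall k, (1 <= k <= n)%N -> F k (E k)) ->
  0 <= c -> (forall k w, (1 <= k <= n)%N -> E k w -> c <= Z k w) ->
  (c%:E * P [set w | exists2 k, (1 <= k <= n)%N & E k w] <=
   \int[P]_w (Z 0 w)%:E)%E.
Proof.
move=> hF; have [F0 sF FS Fm] := hF; move=> mZ Z0 Zdec FE c0 cE.
pose U m := [set w | exists2 k, (1 <= k <= m)%N & E k w].
have Fmeas m : (m <= n)%N -> F m `<=` measurable.
  exact: filtration_measurable hF.
have US m : U m.+1 = U m `|` E m.+1.
  apply/seteqP; split => w /=.
    move=> [k /andP[k1]]; rewrite leq_eqVlt => /orP[/eqP->|km] Ek.
      by right.
    by left; exists k; rewrite ?k1.
  move=> [[k /andP[k1 km] Ek]|Ek]; first by exists k => //; rewrite k1 leqW.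
  by exists m.+1 => //; rewrite leqnn.
have FU m : (m <= n)%N -> F m (U m).
  elim: m => [_|m IH mn].
    suff -> : U 0%N = set0 by rewrite F0; left.
    by apply/seteqP; split => w //= [k]; case: k.
  rewrite US -(sigma_measurableE (sF _ mn)); apply: measurableU.
    rewrite sigma_measurableE; last exact: sF.
    by apply: (FS m mn); apply: IH; exact: ltnW.
  by rewrite sigma_measurableE; [exact: FE|exact: sF].
(* Invariant: the paths that have met some [E k] by time [m] count with value [c], and the others
   still carry [Z m]. *)
suff H m : (m <= n)%N ->
    (c%:E * P (U m) + \int[P]_(w in ~` U m) (Z m w)%:E <=
     \int[P]_w (Z 0 w)%:E)%E.
  apply: le_trans (H n (leqnn _)); apply: leeDl.
  by apply: integral_ge0 => w _; rewrite lee_fin Z0.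
elim: m => [_|m IH mn].
  suff -> : U 0%N = set0 by rewrite measure0 mule0 add0e setC0.
  by apply/seteqP; split => w //= [k]; case: k.
have mn' := ltnW mn.
apply: le_trans (IH mn').
have mU : measurable (U m) by apply: (Fmeas m) => //; exact: FU.
have mE : measurable (E m.+1) by apply: (Fmeas m.+1) => //; exact: FE.
have mD : measurable (E m.+1 `\` U m) by exact: measurableD.
have UD : U m.+1 = U m `|` (E m.+1 `\` U m).
  rewrite US; apply/seteqP; split => w /=; last by move=> [|[]]; [left|right].
  by have [Uw|Uw] := pselect (U m w); [left|move=> [|Ew]//; right].
have FCU : F m (~` U m).
  rewrite -(sigma_measurableE (sF _ mn')); apply: measurableC.
  by rewrite sigma_measurableE; [exact: FU|exact: sF].
have CU : ~` U m = (E m.+1 `\` U m) `|` ~` U m.+1.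
  apply/seteqP; split => w /=.
    move=> Uw; have [Ew|Ew] := pselect (E m.+1 w); first by left.
    by right; rewrite US => -[].
  by move=> [[]//|]; rewrite US => + Uw; apply; left.
(* The complement of [U m] lies in [F m], so [Z m] may be replaced by [Z m.+1] on it. It then splits
   into the paths newly in [E m.+1], where [Z m.+1] is at least [c], and the complement of
   [U m.+1]. *)
rewrite (le_trans _ (leeD2l _ (Zdec _ _ mn FCU)))//.
rewrite UD measureU//; last by rewrite setIDA setIC -setIDA setDv setI0.
rewrite -UD muleDr ?ge0_adde_def ?inE ?mule_ge0//.
rewrite -addeA leeD2l// [X in (_ <= \int[P]_(w in X) _)%E]CU.
have mC : measurable (~` U m.+1).
  by apply: measurableC; rewrite UD; exact: measurableU.
rewrite ge0_integral_setU//.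
- rewrite leeD2r// -integral_cst//; apply: ge0_le_integral => //.
  + exact/measurable_EFinP/measurable_funTS/mZ.
  + by move=> w [Ew _]; rewrite lee_fin cE.
- exact/measurable_EFinP/measurable_funTS/mZ.
- by move=> w _; rewrite lee_fin Z0.
- by apply/disj_setPS => w [[Ew Uw] []]; rewrite US; right.
Qed.
End Doob.

(** * Conditional estimate for a single difference *)

Section OneStep.
Context (d : measure_display) (T : measurableType d) (R : realType)
  (P : probability T R).

(** The sign of the conditional expectation is expressed through integrals of nonnegative functions;
    finiteness of the negative part allows it to be cancelled later. *)
Lemma condexp_le0_integral_pos_neg G (xi : T -> R) (g : T -> \bar R) A :
  G `<=` measurable -> P.-integrable setT (EFin \o xi) ->
  is_condexp P G (EFin \o xi) g -> {ae P, forall w, (g w <= 0)%E} -> G A ->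
  (\int[P]_(w in A) (Num.max (xi w) 0)%:E <=
   \int[P]_(w in A) (Num.max (- xi w) 0)%:E)%E /\
  (\int[P]_(w in A) (Num.max (- xi w) 0)%:E \is a fin_num)%E.
Proof.
move=> Gm ixi [_ ig Eg] g0 GA.
have mA : measurable A by exact: Gm.
have ixA : P.-integrable A (EFin \o xi) by exact: integrableS ixi.
have igA : P.-integrable A g by exact: integrableS ig.
have mxi := measurable_int _ ixA.
have mg := measurable_int _ igA.
have posE w : ((EFin \o xi)^\+ w = (Num.max (xi w) 0)%:E)%E.
  by rewrite funeposE/= EFin_max.
have negE w : ((EFin \o xi)^\- w = (Num.max (- xi w) 0)%:E)%E.
  by rewrite funenegE/= EFin_max.
have gle0 : (\int[P]_(w in A) g w <= 0)%E.
  rewrite integralE.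
  have -> : (\int[P]_(w in A) g^\+ w = 0)%E.
    apply/eqP; rewrite eq_le integral_ge0 ?andbT//.
    rewrite -(@integral0 _ _ _ P A); apply: ae_ge0_le_integral => //.
      exact: measurable_funepos.
    by apply: filterS g0 => w gw _; rewrite funeposE ge_max gw lexx.
  by rewrite add0e leeNl oppe0 integral_ge0.
have fneg : (\int[P]_(w in A) (Num.max (- xi w) 0)%:E \is a fin_num)%E.
  under eq_integral do rewrite -negE.
  rewrite ge0_fin_numE ?integral_ge0//.
  exact: integral_funeneg_lt_pinfty.
split=> //; move: gle0; rewrite Eg// integralE.
under eq_integral do rewrite posE.
under [X in (_ - X <= _ -> _)%E]eq_integral do rewrite negE.
by rewrite sube_le0.
Qed.

(** The second moment of [xi] may be infinite, so the linear term is split: phi(xi) + b xi^- <= a +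
    b xi^+ + c xi^2 is integrated over [A], and the integral of xi^+ is at most that of xi^-. *)
Lemma condexp_quadratic_le G (xi : T -> R) (g sig : T -> \bar R)
    (phi : R -> R) (a b c : R) A :
  G `<=` measurable -> P.-integrable setT (EFin \o xi) ->
  is_condexp P G (EFin \o xi) g -> {ae P, forall w, (g w <= 0)%E} ->
  {ae P, forall w, xi w <= 1} -> measurable_fun setT sig ->
  is_condexp_ge0 P G (fun w => (xi w ^+ 2)%:E) sig ->
  0 <= a -> 0 <= b -> 0 <= c ->
  measurable_fun setT phi -> (forall y, 0 <= phi y) ->
  (forall y, y <= 1 -> phi y <= a + b * y + c * y ^+ 2) -> G A ->
  (\int[P]_(w in A) (phi (xi w))%:E <=
   \int[P]_(w in A) (a%:E + c%:E * sig w))%E.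
Proof.
move=> Gm ixi Eg g0 xi1 msig [_ sig0 Esig] a0 b0 c0 mphi phi0 hphi GA.
have [pn fn] := condexp_le0_integral_pos_neg Gm ixi Eg g0 GA.
have mA : measurable A by exact: Gm.
have mxi : measurable_fun setT xi.
  exact/measurable_EFinP/(measurable_int _ ixi).
pose p w := Num.max (xi w) 0; pose q w := Num.max (- xi w) 0.
have mp : measurable_fun setT p by exact: measurable_funrpos.
have mq : measurable_fun setT q by exact: measurable_funrneg.
have p0 w : 0 <= p w by rewrite le_max lexx orbT.
have q0 w : 0 <= q w by rewrite le_max lexx orbT.
have pq w : xi w = p w - q w.
  rewrite /p /q -[X in X - _]/(Num.max (xi w) 0).
  have [h|h] := leP 0 (xi w).
    by rewrite [Num.max (- xi w) 0]max_r ?subr0// oppr_le0.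
  by rewrite [Num.max (- xi w) 0]max_l ?sub0r ?opprK// oppr_ge0 ltW.
have mphixi : measurable_fun setT (phi \o xi) by exact: measurableT_comp.
have mA_ (f : T -> R) : measurable_fun setT f -> measurable_fun A (EFin \o f).
  by move=> mf; exact/measurable_EFinP/measurable_funTS.
have msA : measurable_fun A sig by exact: measurable_funTS.
have ple : (b%:E * \int[P]_(w in A) (p w)%:E <=
    b%:E * \int[P]_(w in A) (q w)%:E)%E by rewrite lee_wpmul2l.
have qfin : (b%:E * \int[P]_(w in A) (q w)%:E \is a fin_num)%E.
  exact: fin_numM.
have intZ r (f : T -> R) : 0 <= r -> measurable_fun setT f ->
    (forall w, 0 <= f w) ->
    (r%:E * \int[P]_(w in A) (f w)%:E = \int[P]_(w in A) (r * f w)%:E)%E.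
  move=> r0 mf f0; rewrite -ge0_integralZl_EFin//; last exact: mA_.
  by move=> w _; rewrite lee_fin.
have msq : measurable_fun setT (fun w => xi w ^+ 2) by exact: measurable_funX.
have mZ (r : R) (f : T -> R) :
    measurable_fun setT f -> measurable_fun setT (fun w => r * f w).
  by move=> mf; apply: measurable_funM.
(* The finite quantity b times the integral of [q] is added to both sides; on the right it is then
   lowered to the one with [p]. *)
rewrite -(leeD2rE _ _ qfin).
apply: (@le_trans _ _ (\int[P]_(w in A) (a%:E + c%:E * sig w) +
    b%:E * \int[P]_(w in A) (p w)%:E)%E); last by rewrite leeD2l.
have -> : (\int[P]_(w in A) (a%:E + c%:E * sig w) =
    \int[P]_(w in A) (a + c * xi w ^+ 2)%:E)%E.
  under [RHS]eq_integral do rewrite EFinD.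
  rewrite !ge0_integralD//.
  - rewrite -intZ//; last by move=> w; exact: sqr_ge0.
    by rewrite ge0_integralZl_EFin// Esig.
  - by move=> w _; rewrite lee_fin mulr_ge0 ?sqr_ge0.
  - exact/mA_/mZ.
  - by move=> w _; rewrite mule_ge0.
  - exact: measurable_funeM.
rewrite !intZ//.
have mphiA := mA_ _ mphixi.
have mqA := mA_ _ (mZ b _ mq).
have mpA := mA_ _ (mZ b _ mp).
have mxA : measurable_fun A (fun w => (a + c * xi w ^+ 2)%:E).
  apply: (mA_ (fun w => a + c * xi w ^+ 2)).
  by apply: measurable_funD => //; exact: mZ.
have phiA w : A w -> (0 <= (phi (xi w))%:E)%E by rewrite lee_fin.
have qA w : A w -> (0 <= (b * q w)%:E)%E by rewrite lee_fin mulr_ge0.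
have pA w : A w -> (0 <= (b * p w)%:E)%E by rewrite lee_fin mulr_ge0.
have xA w : A w -> (0 <= (a + c * xi w ^+ 2)%:E)%E.
  by rewrite lee_fin addr_ge0// mulr_ge0// sqr_ge0.
rewrite -!ge0_integralD//; apply: ae_ge0_le_integral => //.
- by move=> w Aw; rewrite adde_ge0 ?phiA ?qA.
- exact: emeasurable_funD.
- by move=> w Aw; rewrite adde_ge0 ?xA ?pA.
- exact: emeasurable_funD.
apply: filterS xi1 => w x1 _; rewrite -!EFinD lee_fin.
by have := hphi _ x1; rewrite [in b * _]pq mulrBr; lra.
Qed.
End OneStep.

(** * The crossing events and their adaptedness *)

Definition crossing (T : Type) (R : realType) (xi : nat -> T -> R)
    (condsq : nat -> T -> \bar R) (x v : R) (k : nat) : set T :=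
  [set w | x <= \sum_(1 <= i < k.+1) xi i w /\
           (\sum_(1 <= i < k.+1) condsq i w <= (v ^+ 2)%:E)%E].

Section Bound.
Context (d : measure_display) (T : measurableType d) (R : realType)
  (P : probability T R) (n : nat) (F : nat -> set (set T))
  (xi : nat -> T -> R) (condsq : nat -> T -> \bar R) (x v : R)
  (hn : (1 <= n)%N)
  (hF : filtration n F)
  (hxi : supermartingale_differences P n F xi)
  (hxi1 : forall i, (1 <= i <= n)%N -> {ae P, forall w, xi i w <= 1})
  (hcondsq : forall i, (1 <= i <= n)%N ->
     is_condexp_ge0 P (F i.-1) (fun w => (xi i w ^+ 2)%:E) (condsq i)).

Let E := crossing xi condsq x v.

Lemma xi_wrt i k : (1 <= i <= k)%N -> (k <= n)%N -> measurable_wrt (F k) (xi i).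
Proof.
move=> /andP[i1 ik] kn; have [_ sF _ _] := hF.
have i1n : (1 <= i <= n)%N by rewrite i1 (leq_trans ik).
have [_ mx _] := hxi i1n; case/andP: i1n => _ lin.
apply: measurable_wrt_trans mx; [exact: sF|exact: sF|].
by apply: (filtration_le hF); rewrite ik.
Qed.

(** Predictability: [condsq i] is already measurable for [F i.-1], hence the range up to [k.+1]. *)
Lemma condsq_wrt i k :
  (1 <= i)%N -> (i <= k.+1)%N -> (k <= n)%N -> (i <= n)%N ->
  measurable_wrt (F k) (condsq i).
Proof.
move=> i1 ik kn lin; have [_ sF _ _] := hF.
have i1n : (1 <= i <= n)%N by rewrite i1.
have [mx _ _] := hcondsq i1n.
have ik' : (i.-1 <= k)%N by rewrite -ltnS prednK.
apply: measurable_wrt_trans mx; [|exact: sF|].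
  exact/sF/(leq_trans ik' kn).
by apply: (filtration_le hF); rewrite ik'.
Qed.

Lemma crossing_wrt k : (1 <= k <= n)%N -> F k (E k).
Proof.
move=> /andP[k1 kn]; have [_ sF _ _] := hF.
rewrite -[F k](sigma_measurableE (sF _ kn)).
have -> : E k = [set w : g_sigma_algebraType (F k) |
     (x%:E <= (\sum_(1 <= i < k.+1) xi i w)%:E)%E] `&`
   [set w | (\sum_(1 <= i < k.+1) condsq i w <= (v ^+ 2)%:E)%E].
  by apply/seteqP; split => w; rewrite /E/= lee_fin.
have mX m : (m <= k)%N ->
    measurable_wrt (F k) (fun w => \sum_(1 <= i < m.+1) xi i w).
  elim: m => [_|m IH mk].
    by under eq_fun do rewrite big_geq//; exact: measurable_cst.
  under eq_fun do rewrite big_nat_recr//=.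
  by apply: measurable_funD; [exact: IH (ltnW mk)|exact: xi_wrt].
have mS m : (m <= k)%N ->
    measurable_wrt (F k) (fun w => (\sum_(1 <= i < m.+1) condsq i w)%E).
  elim: m => [_|m IH mk].
    by under eq_fun do rewrite big_geq//; exact: measurable_cst.
  under eq_fun do rewrite big_nat_recr//=.
  apply: emeasurable_funD; first exact: IH (ltnW mk).
  by apply: condsq_wrt => //; [exact: leqW|exact: leq_trans kn].
apply: measurableI; rewrite -[X in measurable X]setTI.
  by apply: emeasurable_fun_c_infty => //; apply/measurable_EFinP; exact: mX.
by apply: emeasurable_fun_infty_c => //; exact: mS.
Qed.

(** * The exponential supermartingale *)

Section Weights.
Variables (a b c l : R).
Let s := v ^+ 2 / n%:R.
Hypotheses (l0 : 0 < l) (b0 : 0 <= b) (c0 : 0 <= c) (a1 : 1 <= a)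
  (hq : forall y, y <= 1 -> expR (l * y) <= a + b * y + c * y ^+ 2).

Let B := a + c * s.
Let kap := c / B.
(** The deterministic part of a factor of [Z]: where [condsq i] is finite,
    [K * D i w * expR (l * xi i w)] is exp(l xi_i - kap (sigma_i^2 - s)) / B. *)
Let K := expR (kap * s) / B.

(* [exp (- kap * condsq i w)], with value 0 where [condsq i w] is infinite. *)
Let D i w :=
  if condsq i w == +oo%E then 0 else expR (- (kap * fine (condsq i w))).
Let Z k w := \prod_(1 <= i < k.+1) (K * D i w * expR (l * xi i w)).

Let s0 : 0 <= s. Proof. by rewrite divr_ge0 ?sqr_ge0. Qed.
Let B1 : 1 <= B. Proof. by rewrite (le_trans a1)// lerDl mulr_ge0. Qed.
Let B0 : 0 < B. Proof. by rewrite (lt_le_trans _ B1). Qed.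
Let kap0 : 0 <= kap. Proof. by rewrite divr_ge0// ltW. Qed.
Let K0 : 0 <= K. Proof. by rewrite divr_ge0 ?expR_ge0// ltW. Qed.
Let D0 i w : 0 <= D i w.
Proof. by rewrite /D; case: ifP => // _; exact: expR_ge0. Qed.
Let Z0 k w : 0 <= Z k w.
Proof. by apply: prodr_ge0 => i _; rewrite mulr_ge0 ?expR_ge0// mulr_ge0. Qed.

Lemma weight_wrt i k :
  (1 <= i)%N -> (i <= k.+1)%N -> (k <= n)%N -> (i <= n)%N ->
  measurable_wrt (F k) (D i).
Proof.
move=> i1 ik kn lin; have mc := condsq_wrt i1 ik kn lin.
apply: measurable_fun_ifT.
- by apply: measurable_fun_eqe.
- exact: measurable_cst.
apply: measurableT_comp => //; apply: measurableT_comp => //.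
by apply: measurable_funM => //; exact: measurableT_comp.
Qed.

Lemma weighted_prod_wrt k : (k <= n)%N -> measurable_wrt (F k) (Z k).
Proof.
move=> kn; apply: measurable_prod => i; rewrite mem_index_iota ltnS.
move=> /andP[i1 ik]; apply: measurable_funM.
  apply: measurable_funM => //; apply: weight_wrt => //; first exact: leqW.
  exact: leq_trans kn.
apply: measurableT_comp => //; apply: measurable_funM => //.
by apply: xi_wrt => //; rewrite i1.
Qed.

(** Since a + c r = B (1 + kap (r - s)), this is 1 + u <= exp(u) at u = kap (r - s). *)
Lemma weight_le i w : (1 <= i <= n)%N ->
  ((K * D i w)%:E * (a%:E + c%:E * condsq i w) <= 1)%E.
Proof.
move=> i1n; have [_ /(_ w) c0' _] := hcondsq i1n.
(* Where [condsq i] is infinite the weight vanishes, and 0 times +oo is 0. *)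
rewrite /D; case: eqP => [_|/eqP]; first by rewrite mulr0 mul0e.
case: (condsq i w) c0' => [r| |]//; rewrite lee_fin => r0 _ /=; rewrite lee_fin.
have -> : a + c * r = B * (1 + kap * (r - s)).
  by rewrite /kap /B; field; rewrite gt_eqF.
rewrite mulrAC /K.
have -> : expR (kap * s) / B * (B * (1 + kap * (r - s))) =
  expR (kap * s) * (1 + kap * (r - s)) by field; rewrite gt_eqF.
apply: (@le_trans _ _
  (expR (kap * s) * expR (kap * (r - s)) * expR (- (kap * r)))).
  by rewrite ler_wpM2r ?expR_ge0// ler_wpM2l ?expR_ge0// expR_ge1Dx.
rewrite -!expRD le_eqVlt; apply/orP; left; apply/eqP.
by rewrite -expR0; congr expR; ring.
Qed.

Lemma weighted_prod_supermartingale k A : (k < n)%N -> F k A ->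
  (\int[P]_(w in A) (Z k.+1 w)%:E <= \int[P]_(w in A) (Z k w)%:E)%E.
Proof.
move=> kn FA; have [_ sF _ _] := hF.
have kn' := ltnW kn.
have k1 : (1 <= k.+1 <= n)%N by [].
have Fm := filtration_measurable hF kn'.
have mA : measurable A by exact: Fm.
have [ixi _ [g Eg g0]] := hxi k1.
have Ec := hcondsq k1.
have mc : measurable_fun setT (condsq k.+1).
  by apply: measurable_wrt_fun (sF _ kn') Fm _; exact: condsq_wrt.
have mx : measurable_fun setT (xi k.+1).
  exact/measurable_EFinP/(measurable_int _ ixi).
have mZ : measurable_fun setT (Z k).
  by apply: measurable_wrt_fun (sF _ kn') Fm _; exact: weighted_prod_wrt.
(* By predictability of [D k.+1], everything in [Z k.+1] on [A] except exp(l xi_{k+1}) is measurable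
   for [F k]. That factor is then bounded by the parabola, and [weight_le] absorbs the result. *)
pose Y w := (\1_A w * (Z k w * (K * D k.+1 w)))%:E.
have mY : measurable_wrt (F k) Y.
  apply/measurable_EFinP; apply: measurable_funM.
    by apply: measurable_indic; rewrite sigma_measurableE//; exact: sF.
  apply: measurable_funM; first exact: weighted_prod_wrt.
  by apply: measurable_funM => //; exact: weight_wrt.
have Y0 w : (0 <= Y w)%E.
  rewrite lee_fin mulr_ge0 ?indicE ?ler0n// mulr_ge0 ?Z0//.
  by rewrite mulr_ge0 ?D0.
have [_ c0' _] := Ec.
have mw : measurable_fun setT (fun w => (a%:E + c%:E * condsq k.+1 w)%E).
  by apply: emeasurable_funD => //; exact: measurable_funeM.
have w0 w : (0 <= a%:E + c%:E * condsq k.+1 w)%E.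
  by rewrite adde_ge0 ?mule_ge0// lee_fin (le_trans _ a1).
apply: (@le_trans _ _ (\int[P]_w (Y w * (expR (l * xi k.+1 w))%:E))%E).
  rewrite integral_mkcond le_eqVlt; apply/orP; left; apply/eqP.
  apply: eq_integral => w _; rewrite /patch /Y indicE.
  case: ifP => _; last by rewrite mul0r mul0e.
  by rewrite -EFinM /Z big_nat_recr//= mul1r mulrA.
apply: (@le_trans _ _ (\int[P]_w (Y w * (a%:E + c%:E * condsq k.+1 w)))%E).
  apply: (le_integral_measurable_wrtM (sF _ kn') Fm) => //.
    by apply: measurableT_comp => //; exact: measurable_funM.
  move=> A' FA'.
  apply: (condexp_quadratic_le (phi := fun y => expR (l * y))
    Fm ixi Eg g0 _ mc Ec _ b0 c0 _ _ hq FA').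
  - exact: hxi1.
  - by rewrite (le_trans _ a1).
  - by apply: measurableT_comp => //; exact: measurable_funM.
  - by move=> y; exact: expR_ge0.
rewrite [leRHS]integral_mkcond; apply: ge0_le_integral => //.
- by move=> w _; rewrite mule_ge0.
- apply: emeasurable_funM => //; exact: measurable_wrt_fun (sF _ kn') Fm mY.
- by apply/(measurable_restrictT _ mA)/measurable_EFinP/measurable_funTS.
move=> w _; rewrite /patch /Y indicE.
case: ifP => _; last by rewrite mul0r mul0e.
rewrite mul1r EFinM -muleA -[leRHS]mule1 lee_wpmul2l ?lee_fin//.
exact: weight_le.
Qed.

Lemma weighted_prod_ge k w : (1 <= k <= n)%N -> E k w ->
  expR (l * x) / B ^+ n <= Z k w.
Proof.
move=> /andP[k1 kn] [xX sigv].
have sig0 i : (1 <= i < k.+1)%N -> (0 <= condsq i w)%E.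
  move=> /andP[i1 ik].
  by have [|_ ->] := @hcondsq i; rewrite ?i1 ?(leq_trans _ kn).
(* On the crossing event each [condsq i] is a nonnegative term of a sum bounded by v^2, so the
   default value of [D] does not occur. *)
have sigfin i : (1 <= i < k.+1)%N -> condsq i w \is a fin_num.
  move=> ik; rewrite ge0_fin_numE ?sig0//.
  apply: le_lt_trans (ltry (v ^+ 2)); apply: le_trans sigv.
  rewrite (bigD1_seq i) ?mem_index_iota ?iota_uniq//=; apply: leeDl.
  rewrite big_seq_cond; apply: sume_ge0 => j /andP[].
  by rewrite mem_index_iota => jk _; exact: sig0.
have {}sigv : \sum_(1 <= i < k.+1) fine (condsq i w) <= v ^+ 2.
  rewrite -lee_fin -sumEFin; apply: le_trans sigv.
  rewrite le_eqVlt; apply/orP; left; apply/eqP.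
  by apply: eq_big_nat => i ik; rewrite fineK// sigfin.
have -> : Z k w = expR (l * \sum_(1 <= i < k.+1) xi i w +
    kap * (k%:R * s - \sum_(1 <= i < k.+1) fine (condsq i w))) / B ^+ k.
  have -> : Z k w = \prod_(1 <= i < k.+1)
      (expR (l * xi i w + kap * (s - fine (condsq i w))) / B).
    apply: eq_big_nat => i ik; rewrite /D; move: (sigfin _ ik).
    case: (condsq i w) => // r _ /=.
    rewrite /K mulrAC -mulrA mulrAC -mulrA -!expRD.
    rewrite mulrA -expRD; congr (expR _ / B); ring.
  rewrite big_split/= -expR_sum prodr_const_nat subn1/= exprVn.
  by rewrite big_split/= -!mulr_sumr sumrB sumr_const_nat subn1/= mulr_natl.
(* A crossing at time [k] supplies only [k] factors 1/B; this bound pays for the other n - k. *)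
have hB : expR (kap * s) <= B.
  have : B * (1 - kap * s) <= B * expR (- (kap * s)).
    by rewrite ler_pM2l// expR_ge1Dx.
  have -> : B * (1 - kap * s) = a by rewrite /kap /B; field; rewrite gt_eqF.
  move/(le_trans a1); rewrite expRN -[B * _]/(B / _).
  by rewrite ler_pdivlMr ?expR_gt0// mul1r.
have -> : B ^+ n = B ^+ k * B ^+ (n - k) by rewrite -exprD subnKC.
rewrite invfM mulrA mulrAC ler_pM2r ?invr_gt0 ?exprn_gt0//.
rewrite ler_pdivrMr ?exprn_gt0//.
apply: (@le_trans _ _ (expR (l * \sum_(1 <= i < k.+1) xi i w +
    kap * (k%:R * s - \sum_(1 <= i < k.+1) fine (condsq i w))) *
    expR (kap * s) ^+ (n - k))); last first.
  by rewrite ler_wpM2l ?expR_ge0// lerXn2r// nnegrE ?expR_ge0 ?ltW.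
rewrite -expRM_natl -expRD ler_expR natrB//.
have vE : v ^+ 2 = n%:R * s by rewrite /s; field; rewrite pnatr_eq0 -lt0n.
rewrite vE in sigv.
have h1 : l * x <= l * \sum_(1 <= i < k.+1) xi i w by rewrite ler_pM2l.
have h2 : 0 <= kap * (n%:R * s - \sum_(1 <= i < k.+1) fine (condsq i w)).
  by rewrite mulr_ge0// subr_ge0.
lra.
Qed.

Lemma crossing_le_expR :
  (P [set w | exists2 k, (1 <= k <= n)%N & E k w] <=
   (expR (- (l * x)) * B ^+ n)%:E)%E.
Proof.
have cpos : 0 < expR (l * x) / B ^+ n by rewrite divr_gt0 ?expR_gt0 ?exprn_gt0.
have [_ sF _ _] := hF.
have mZ k : (k <= n)%N -> measurable_fun setT (Z k).
  move=> kn; apply: measurable_wrt_fun (sF _ kn) _ _.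
    exact: filtration_measurable hF kn.
  exact: weighted_prod_wrt.
have := maximal_inequality hF mZ (fun k w _ => Z0 k w)
  weighted_prod_supermartingale crossing_wrt (ltW cpos) weighted_prod_ge.
(* [Z 0] is an empty product, so its integral is the total mass. *)
under eq_integral do rewrite /Z big_geq//.
rewrite integral_cst// mul1e => h0.
have {h0}h := le_trans h0 (probability_le1 P measurableT).
have -> : expR (- (l * x)) * B ^+ n = (expR (l * x) / B ^+ n)^-1.
  by rewrite invf_div expRN mulrC.
rewrite -[leLHS]mul1e -(mulVf (lt0r_neq0 cpos)) EFinM -muleA -[leRHS]mule1.
by rewrite lee_pmul2l// lte_fin invr_gt0.
Qed.
End Weights.
End Bound.

(** * Boundary values of x and the conclusion *)

Theorem theorem2p1 (d : measure_display) (T : measurableType d) (R : realType)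
    (P : probability T R) (n : nat) (F : nat -> set (set T))
    (xi : nat -> T -> R) (condsq : nat -> T -> \bar R) (x v : R)
    (hn : (1 <= n)%N)
    (hF : filtration n F)
    (hxi : supermartingale_differences P n F xi)
    (hxi1 : forall i, (1 <= i <= n)%N -> {ae P, forall w, xi i w <= 1})
    (hcondsq : forall i, (1 <= i <= n)%N ->
       is_condexp_ge0 P (F i.-1) (fun w => (xi i w ^+ 2)%:E) (condsq i))
    (hx : 0 <= x) (hv : 0 < v) :
  (P [set w | exists2 k : nat, (1 <= k <= n)%N &
        (x <= \sum_(1 <= i < k.+1) xi i w)%R /\
        \sum_(1 <= i < k.+1) condsq i w <= (v ^+ 2)%:E]
     <= (H n x v)%:E)%E.
Proof.
pose E := crossing xi condsq x v.
pose U := [set w | exists2 k, (1 <= k <= n)%N & E k w].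
rewrite -/U; have mU : measurable U.
  have -> : U = \bigcup_(k in [set k | (1 <= k <= n)%N]) E k.
    by apply/seteqP; split => w [k kn Ek]; exists k.
  apply: bigcup_measurable => k /= k1n.
  have kn : (k <= n)%N by case/andP: k1n.
  apply: (filtration_measurable hF kn).
  exact: (crossing_wrt _ _ hF hxi hcondsq).
have v2 : 0 < v ^+ 2 by rewrite exprn_gt0.
(* At x = 0 the optimal parameter would be 0, but there [H] equals 1. *)
have [x0|x0] := eqVneq x 0.
  suff -> : H n x v = 1 by exact: probability_le1.
  rewrite /H x0 ler0n add0r subr0.
  by rewrite !divff ?powR1 ?mulr1 ?powR1 ?gt_eqF// ltr0n.
have {hx x0} hx : 0 < x by rewrite lt_neqAle eq_sym x0.
(* For x > n the bound is 0, and the event is null because almost surely X_k <= k <= n. *)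
have [xn|nx] := leP x n%:R; last first.
  rewrite /H ifF; last by apply/negbTE; rewrite -ltNge.
  suff -> : P U = 0%E by [].
  apply/(negligibleP _ mU).
  have xi_le1 : {ae P, forall w, forall i, (1 <= i <= n)%N -> xi i w <= 1}.
    apply: ae_foralln => i; have [i1n|i1n] := boolP (1 <= i <= n)%N.
      by apply: filterS (hxi1 i i1n).
    exact: filterE.
  apply: negligibleS xi_le1.
  move=> w [k /andP[k1 kn] [xX _]] /= xi1; move: xX; apply/negP; rewrite -ltNge.
  apply: le_lt_trans nx; apply: (@le_trans _ _ k%:R); last by rewrite ler_nat.
  rewrite -[k in k%:R]subn0 -(subSS 0 k) -sumr_const_nat.
  apply: ler_sum_nat => i /andP[i1 ik]; apply: xi1.
  by rewrite i1 (leq_trans _ kn).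
rewrite -(fineK (fin_num_measure P _ mU)) lee_fin.
apply: le_H => //; first by rewrite hx.
move=> l l0; rewrite -lee_fin fineK ?fin_num_measure//.
have s0 : 0 <= v ^+ 2 / n%:R by rewrite divr_ge0// ltW.
have [a [b [c [b0 c0 <- hq]]]] := expR_le_quadratic s0 l0.
have a1 : 1 <= a.
  by have := hq 0 ler01; rewrite mulr0 expR0 expr0n !mulr0 !addr0.
exact: (crossing_le_expR _ _ hn hF hxi hxi1 hcondsq l0 b0 c0 a1 hq).
Qed.
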